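(* For each P-ideal $\mathcal{I}$ on $\omega$ with the Baire property, $\mathfrak{b}_R(\mathcal{I})=\mathfrak{b}(\mathcal{I})=\mathfrak{b}$.
   Context: $\mathfrak{b}$ is the bounding number. An ideal on $\omega$ is a nonempty family $\mathcal{I}\subseteq\mathcal{P}(\omega)$ closed under finite unions and under subsets, containing all finite sets, and with $\omega\notin\mathcal{I}$; $\mathcal{I}^+=\mathcal{P}(\omega)\setminus\mathcal{I}$. $\mathcal{I}$ is a P-ideal if for every sequence $\langle A_n\rangle$ of elements of $\mathcal{I}$ there is $A\in\mathcal{I}$ with $A_n\setminus A$ finite for all $n$. $\mathcal{P}(\omega)$ is identified with $2^\omega$ (product topology); $\mathcal{I}$ has the Baire property if it has it as a subset of this space. $\mathcal{D}_\mathcal{I}$ is the set of $f:\omega\to\omega$ with $f^{-1}(\{n\})\in\mathcal{I}$ for all $n$; $\mathfrak{b}(\mathcal{I})$ is the least cardinality of a family $\mathcal{F}\subseteq\mathcal{D}_\mathcal{I}$ such that for every $g\in\mathcal{D}_\mathcal{I}$ there is $f\in\mathcal{F}$ with $\{n: f(n)<g(n)\}\notin\mathcal{I}$. Families $\mathcal{A},\mathcal{B}$ are $\mathcal{I}$-orthogonal if $A\cap B\in\mathcal{I}$ for all $A\in\mathcal{A}$, $B\in\mathcal{B}$; $C$ $\mathcal{I}$-separates $(\mathcal{A},\mathcal{B})$ if $A\cap C\in\mathcal{I}$ and $B\setminus C\in\mathcal{I}$ for all $A\in\mathcal{A}$, $B\in\mathcal{B}$. An $\mathcal{I}$-gap is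 a pair $(\mathcal{A},\mathcal{B})$ of $\mathcal{I}$-orthogonal subfamilies of $\mathcal{I}^+$ not $\mathcal{I}$-separated by any set; an $\mathcal{I}$-$(\kappa,\lambda)$-gap has $|\mathcal{A}|=\kappa$, $|\mathcal{B}|=\lambda$. $\mathfrak{b}_R(\mathcal{I})$ is the least $\kappa$ such that there is an $\mathcal{I}$-$(\omega,\kappa)$-gap, and $\mathfrak{c}^+$ if none exists. *)

(* Defs.v *)
From mathcomp Require Import all_boot.
From mathcomp Require Import boolp classical_sets functions cardinality.
From mathcomp Require Import topology cantor.

Set Implicit Arguments.
Unset Strict Implicit.
Unset Printing Implicit Defensive.

Local Open Scope classical_set_scope.
Local Open Scope card_scope.

(* Cardinals are handled relationally: a cardinal is represented by any set
   having that cardinality, and equality of cardinals is [#=]. *)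

(* A set of least cardinality among those satisfying [P]. *)
Definition least_card (T : Type) (P : set (set T)) : set T :=
  xget set0 [set A | P A /\ forall B, P B -> A #<= B].

(* Well-foundedness of [#<=]: [least_card P] never takes the default value
   [set0] when some set satisfies [P]. *)
Lemma least_cardP (T : Type) (P : set (set T)) : P !=set0 ->
  P (least_card P) /\ forall B, P B -> least_card P #<= B.
Proof.
move=> [X0 PX0]; apply: (@xgetPex _ set0 [set A | P A /\ _]).
pose Q (G : set (set T -> T)) :=
  (forall f A, G f -> P A -> A (f A)) /\
  (forall f g A, G f -> G g -> P A -> f A = g A -> f = g).
have [F FQ totF|G [[Gin Ginj] Gmax]] := @Zorn_bigcup _ (Q : set _).
  split=> [f A [X FX Xf] PA|f g A [X FX Xf] [Y FY Yg] PA].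
    by have [H _] := FQ _ FX; exact: (H f A Xf PA).
  have [XY|YX] := totF _ _ FX FY.
    by have [_ H] := FQ _ FY; apply: H Yg PA => //; exact: XY.
  by have [_ H] := FQ _ FX; apply: H PA => //; exact: YX.
have [A [PA Asurj]] :
    exists A, P A /\ forall a, A a -> exists f, G f /\ f A = a.
  apply: contrapT => noA.
  have wit A : exists a, P A -> A a /\ forall f, G f -> f A <> a.
    have [PA|nPA] := pselect (P A).
      apply: contrapT => noa; apply: noA; exists A; split=> // a Aa.
      apply: contrapT => nof; apply: noa; exists a => _; split=> // f Gf fAa.
      by apply: nof; exists f.
    have [a _] : exists a : T, True.
      apply: contrapT => nT; apply: noA; exists X0; split=> // a.
      by exfalso; apply: nT; exists a.
    by exists a.
  have [h hP] := choice wit.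
  apply: (Gmax (G `|` [set h])).
    split; first by move=> f Gf; left.
    move=> /(_ h) Gh.
    by have [_ /(_ h)] := hP _ PX0; apply=> //; apply: Gh; right.
  split=> [f B [Gf|->] PB|f g B [Gf|->] [Gg|->] PB]; first exact: (Gin f B Gf PB).
  - by case: (hP _ PB).
  - exact: Ginj.
  - by move=> e; have [_ /(_ _ Gf)] := hP _ PB.
  - by move=> e; have [_ /(_ _ Gg)] := hP _ PB; rewrite -e.
  - by [].
exists A; split=> // B PB.
have [->|/set0P[x0 _]] := eqVneq A set0; first exact: card_ge0.
have wit a : exists f, A a -> G f /\ f A = a.
  have [Aa|nAa] := pselect (A a); last by exists (fun=> x0).
  by have [f ?] := Asurj _ Aa; exists f.
have [F FP] := choice wit.
apply: (@card_le_trans _ _ _ ((fun a => F a B) @` A)); last first.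
  apply: subset_card_le => _ [a Aa <-].
  by have [Gf _] := FP _ Aa; exact: (Gin (F a) B Gf PB).
have /card_esym/card_eqPle[] // : (fun a => F a B) @` A #= A.
apply: inj_card_eq => a b /set_mem Aa /set_mem Ab e.
have [[Ga ea] [Gb eb]] := (FP _ Aa, FP _ Ab).
by rewrite -ea -eb (Ginj _ _ _ Ga Gb PB e).
Qed.

Definition eventually_le (f g : nat -> nat) := finite_set [set n | g n < f n].

Definition unbounded_family (F : set (nat -> nat)) :=
  ~ exists g, forall f, F f -> eventually_le f g.

Definition bounding_number : set (nat -> nat) := least_card unbounded_family.

Lemma unbounded_family_setT : unbounded_family [set: nat -> nat].
Proof.
move=> [g /(_ (fun n => (g n).+1) I)]; rewrite /eventually_le.
suff -> : [set n | g n < (g n).+1] = [set: nat].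
  by move=> /finite_setPn; apply; exact: card_lexx.
by apply/seteqP; split=> n //= _; exact: ltnSn.
Qed.

Record is_ideal (I : set (set nat)) : Prop := IsIdeal {
  ideal_nonempty : I !=set0;
  ideal_setU : forall A B, I A -> I B -> I (A `|` B);
  ideal_subset : forall A B, A `<=` B -> I B -> I A;
  ideal_finite : forall A, finite_set A -> I A;
  ideal_proper : ~ I [set: nat] }.

Definition is_P_ideal (I : set (set nat)) :=
  is_ideal I /\
  forall A_ : nat -> set nat, (forall n, I (A_ n)) ->
    exists2 A, I A & forall n, finite_set (A_ n `\` A).

Definition nowhere_dense (T : topologicalType) (A : set T) :=
  interior (closure A) = set0.

Definition meager (T : topologicalType) (A : set T) :=
  exists F : nat -> set T,
    (forall n, nowhere_dense (F n)) /\ A = \bigcup_n F n.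

Definition has_Baire_property (T : topologicalType) (A : set T) :=
  exists2 O : set T, open O & meager (A `+` O).

(* A point of the Cantor space is identified with the subset of [nat] of which
   it is the characteristic function. *)
Definition cantor_family (I : set (set nat)) : set cantor_space :=
  [set x : cantor_space | I [set n | x n]].

Definition D_ideal (I : set (set nat)) : set (nat -> nat) :=
  [set f | forall n, I (f @^-1` [set n])].

Definition ideal_unbounded (I : set (set nat)) (F : set (nat -> nat)) :=
  F `<=` D_ideal I /\
  forall g, D_ideal I g -> exists2 f, F f & ~ I [set n | f n < g n].

Definition ideal_bounding_number (I : set (set nat)) : set (nat -> nat) :=
  least_card (ideal_unbounded I).

Lemma ideal_unbounded_D_ideal (I : set (set nat)) : is_ideal I ->
  ideal_unbounded I (D_ideal I).
Proof.
move=> [_ IU Isub _ IT]; split=> // g Dg; exists (fun n => (g n).-1).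
  move=> k; apply: Isub (IU _ _ (Dg k.+1) (Dg 0)) => n /=.
  by case: (g n) => [|m]; [right|left => /=; congr S].
move=> Ilt; apply: IT; apply: Isub (IU _ _ Ilt (Dg 0)) => n _ /=.
by case: (g n) => [|m]; [right|left].
Qed.

Definition orthogonal (I : set (set nat)) (A B : set (set nat)) :=
  forall a b, A a -> B b -> I (a `&` b).

Definition separates (I : set (set nat)) (c : set nat) (A B : set (set nat)) :=
  (forall a, A a -> I (a `&` c)) /\ (forall b, B b -> I (b `\` c)).

Definition is_gap (I : set (set nat)) (A B : set (set nat)) :=
  [/\ A `<=` ~` I, B `<=` ~` I, orthogonal I A B &
      ~ exists c, separates I c A B].

(* The cardinals kappa and lambda are represented by the sets [K] and [L]. *)
Definition has_gap (I : set (set nat)) (T U : Type) (K : set T) (L : set U) :=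
  exists A B, [/\ is_gap I A B, A #= K & B #= L].

(* [set (set nat)] has cardinality 2 ^ continuum, so its subsets represent all
   cardinals up to the successor of the continuum. *)
Definition continuum_succ : set (set (set nat)) :=
  least_card [set K | [set: set nat] #<= K /\ ~ (K #<= [set: set nat])].

Lemma gt_continuum_setT :
  [set: set nat] #<= [set: set (set nat)] /\
  ~ ([set: set (set nat)] #<= [set: set nat]).
Proof.
split.
  apply: (@card_le_trans _ _ _ (set1 @` [set: set nat])); last exact: card_leT.
  have /card_esym/card_eqPle[] // : set1 @` [set: set nat] #= [set: set nat].
  by apply: inj_card_eq => a b _ _ e; have : [set a] a by []; rewrite e.
move=> /pcard_leTP/injPex[f finj].
pose d := [set x | exists2 c, f c = x & ~ c x].
have [/[dup] dfd [c /finj e nc]|nd] := pselect (d (f d)).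
  by apply: nc; rewrite e ?inE.
by apply: (nd); exists d.
Qed.

Definition rothberger_number (I : set (set nat)) : set (set (set nat)) :=
  if pselect (exists K : set (set (set nat)), has_gap I [set: nat] K)
  then least_card [set K : set (set (set nat)) | has_gap I [set: nat] K]
  else continuum_succ.

(* Main.v *)
(** An ideal with the Baire property is meager, since otherwise it would contain
two sets that are complementary up to a finite set. Hence (Talagrand) there is a
finite-to-one [h] such that every member of [I] contains only finitely many
fibres of [h]. In a P-ideal, countably many members are covered up to finite
remainders by a single member, and these remainders are bounded by a function
[nat -> nat]; so ideal-bounded families, and families separated from a countable
one, correspond to bounded families of functions. Conversely an unbounded family
is transported along [h]: to its inverse functions for b(I), and to the regions
under its graphs, opposed to the columns of [nat * nat], for b_R(I). *)

Require Import Defs.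
From mathcomp Require Import all_boot.
From mathcomp Require Import boolp classical_sets functions cardinality.
From mathcomp Require Import topology cantor.

Set Implicit Arguments.
Unset Strict Implicit.
Unset Printing Implicit Defensive.

Local Open Scope classical_set_scope.
Local Open Scope card_scope.

(** * Cylinders and nowhere dense sets in the Cantor space *)

Definition cylinder (x : cantor_space) (n : nat) : set cantor_space :=
  [set z | forall j, j < n -> z j = x j].

Lemma nbhs_cylinder (x : cantor_space) (n : nat) : nbhs x (cylinder x n).
Proof.
elim: n => [|n IH]; first by apply: filterS filterT => z _ j.
have nx : nbhs x [set z : cantor_space | z n = x n].
  exact: (@proj_continuous _ (fun=> bool) n x _ (discrete_set1 (x n))).
apply: filterS (filterI IH nx) => z [zx zn] j.
by rewrite ltnS leq_eqVlt => /predU1P[->|/zx].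
Qed.

Lemma cylinder_nbhs (x : cantor_space) (V : set cantor_space) :
  nbhs x V -> exists n, cylinder x n `<=` V.
Proof.
pose G := filter_from [set: nat] (cylinder x).
have GF : Filter G.
  apply: filter_from_filter; first by exists 0.
  move=> i j _ _; exists (maxn i j) => // z zx.
  by split=> k kl; apply: zx; rewrite leq_max kl ?orbT.
have Gx : G --> x.
  (* Convergence in the product topology is checked coordinatewise; agreement on the first [N.+1]
     bits fixes bit [N]. *)
  apply/cvg_sup => N U [W [[Q oQ <-] QxN QU]].
  exists N.+1 => // z zx; apply: QU.
  by rewrite /= zx.
by move=> /Gx [n _ nV]; exists n.
Qed.

(* Nowhere density in the Cantor space, read on finite binary sequences. *)
Definition avoidable (F : set cantor_space) :=
  forall x n, exists y m, [/\ n <= m, cylinder x n y & cylinder y m `<=` ~` F].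

Lemma nowhere_dense_avoidable (F : set cantor_space) :
  nowhere_dense F -> avoidable F.
Proof.
move=> F0 x n.
have [y [xy nFy]] : exists y, cylinder x n y /\ ~ closure F y.
  apply: contrapT => H; have : interior (closure F) x; last by rewrite F0.
  apply: filterS (nbhs_cylinder x n) => y xy.
  by apply: contrapT => nFy; apply: H; exists y.
have [V [yV VF]] : exists V, nbhs y V /\ ~ (F `&` V !=set0).
  apply: contrapT => H; apply: nFy => V yV.
  by apply: contrapT => nV; apply: H; exists V.
have [m mV] := cylinder_nbhs yV.
exists y, (maxn n m); split=> //; first exact: leq_maxl.
move=> z zy Fz; apply: VF; exists z; split=> //; apply: mV => j jm.
by apply: zy; rewrite leq_max jm orbT.
Qed.

Lemma avoidableU (F G : set cantor_space) :
  avoidable F -> avoidable G -> avoidable (F `|` G).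
Proof.
move=> aF aG x n; have [y [m [nm xy yF]]] := aF x n.
have [w [p [mp yw wG]]] := aG y m.
exists w, p; split; first exact: leq_trans mp.
  by move=> j jn; rewrite yw ?xy// (leq_trans jn).
move=> z zw [|]; last exact: wG.
by apply: yF => j jm; rewrite zw ?yw// (leq_trans jm).
Qed.

Lemma avoidable_bigcup_le (F : nat -> set cantor_space) (k : nat) :
  (forall i, avoidable (F i)) -> avoidable (\bigcup_(i in [set i | i <= k]) F i).
Proof.
move=> aF; elim: k => [|k IH].
  suff -> : \bigcup_(i in [set i | i <= 0]) F i = F 0 by [].
  apply/seteqP; split=> [z [i /=]|z Fz]; last by exists 0.
  by rewrite leqn0 => /eqP ->.
suff -> : \bigcup_(i in [set i | i <= k.+1]) F i =
    \bigcup_(i in [set i | i <= k]) F i `|` F k.+1 by exact: avoidableU.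
apply/seteqP; split=> [z [i /=]|z [[i /= ik Fi]|Fz]].
- by rewrite leq_eqVlt => /predU1P[->|ik Fi]; [right|left; exists i].
- by exists i => //=; rewrite (leq_trans ik).
- by exists k.+1 => /=.
Qed.

Definition flip (n : nat) (x : cantor_space) : cantor_space :=
  fun j => if j == n then ~~ x j else x j.

Lemma flipK n : involutive (flip n).
Proof.
by move=> x; apply/funext => j; rewrite /flip; case: eqP => // _; rewrite negbK.
Qed.

Lemma cylinder_flip n p x y :
  cylinder x n y -> cylinder (flip p x) n (flip p y).
Proof. by move=> xy j jn; rewrite /flip xy. Qed.

Lemma avoidable_flip n F : avoidable F -> avoidable (flip n @^-1` F).
Proof.
move=> aF x p; have [y [m [pm xy yF]]] := aF (flip n x) p.
exists (flip n y), m; split=> //.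
  by rewrite -[x](flipK n); exact: cylinder_flip.
move=> z /(cylinder_flip n); rewrite flipK; exact: yF.
Qed.

Definition tail_saturation (n : nat) (F : set cantor_space) : set cantor_space :=
  [set z | exists2 w, F w & forall j, n <= j -> w j = z j].

(** Induction frees one coordinate at a time: freeing bit [n] adds only a preimage under [flip n],
    which preserves avoidability. *)
Lemma avoidable_tail_saturation n F :
  avoidable F -> avoidable (tail_saturation n F).
Proof.
move=> aF; elim: n => [|n IH].
  suff -> : tail_saturation 0 F = F by [].
  apply/seteqP; split=> [z [w Fw wz]|z Fz]; last by exists z.
  by suff <- : w = z by []; apply/funext => j; exact: wz.
suff -> : tail_saturation n.+1 F =
    tail_saturation n F `|` flip n @^-1` tail_saturation n F.
  exact/avoidableU/avoidable_flip.
apply/seteqP; split=> [z [w Fw wz]|z [|] [w Fw wz]].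
- have [e|e] := eqVneq (w n) (z n); [left|right]; exists w => // j.
    by rewrite leq_eqVlt => /predU1P[<-|/wz].
  rewrite /flip leq_eqVlt => /predU1P[<-|nj]; last first.
    by rewrite gtn_eqF// wz.
  by rewrite eqxx; case: (w n) (z n) e => [] [].
- by exists w => // j nj; apply: wz; exact: ltnW.
- by exists w => // j nj; rewrite wz ?(ltnW nj)// /flip gtn_eqF.
Qed.

(** In the tail saturation the bits below [n] are irrelevant, so a pattern placed on one block
    starting at [n] already keeps a point out of [F]. *)
Lemma avoidable_block (F : set cantor_space) (n : nat) : avoidable F ->
  exists (y : cantor_space) m, n < m /\
    forall z : cantor_space, (forall j, n <= j < m -> z j = y j) -> ~ F z.
Proof.
move=> /(avoidable_tail_saturation n) aF.
have [y [m [nm _ yF]]] := aF (fun=> false) n.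
(* The successor keeps the block nonempty when [m = n]. *)
exists y, m.+1; split=> // z zy Fz.
apply: (yF (fun j => if j < n then y j else z j)).
  by move=> j jm; case: ltnP => // nj; rewrite zy// nj ltnS ltnW.
by exists z => // j; case: ltnP.
Qed.

(* One sequence [y] and one partition of [nat] into finite blocks (the fibres
   of [h]) serve all the [F i]: matching [y] on a late block avoids the early
   [F i]. *)
Lemma matching_blocks (F : nat -> set cantor_space) :
  (forall i, avoidable (F i)) ->
  exists (h : nat -> nat) (y : cantor_space),
    (forall k, finite_set (h @^-1` [set k])) /\
    forall k (z : cantor_space), (forall j, h j = k -> z j = y j) ->
      forall i, i <= k -> ~ F i z.
Proof.
move=> aF.
(* A state is the index of a block with its left end; the step returns a bit pattern and the right
   end. *)
have step (kn : nat * nat) : exists ym : cantor_space * nat, kn.2 < ym.2 /\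
    forall z : cantor_space, (forall j, kn.2 <= j < ym.2 -> z j = ym.1 j) ->
      forall i, i <= kn.1 -> ~ F i z.
  have [y [m [nm ymF]]] := avoidable_block kn.2 (avoidable_bigcup_le kn.1 aF).
  by exists (y, m); split=> // z /ymF + i ik Fz; apply; exists i.
have [s sP] := choice step.
pose b := fix b k := if k is k'.+1 then (s (k', b k')).2 else 0.
have blt k : b k < b k.+1 by have [] := sP (k, b k).
have bmono : {homo b : i j / i <= j}.
  exact: (homo_leq leqnn leq_trans (fun k => ltnW (blt k))).
have bge k : k <= b k by elim: k => // k IH; exact: leq_ltn_trans (blt k).
have ex j : exists k, j < b k.+1 by exists j; exact: leq_trans (bge _).
pose h j := ex_minn (ex j).
have hP j k : (h j = k) <-> (b k <= j < b k.+1).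
  rewrite /h; case: ex_minnP => m jm mmin; split=> [<-|/andP[kj jk]].
    rewrite jm andbT leqNgt; apply/negP; case: m jm mmin => // m _ mmin jm.
    by have := mmin _ jm; rewrite ltnn.
  apply/eqP; rewrite eqn_leq mmin//=; rewrite leqNgt; apply/negP => mk.
  by have := leq_trans jm (bmono _ _ mk); rewrite ltnNge kj.
exists h, (fun j => (s (h j, b (h j))).1 j); split=> [k|k z zy].
  apply: (sub_finite_set _ (finite_II (b k.+1))) => j /= /hP.
  by case/andP.
have [_ /(_ z)] := sP (k, b k); apply=> j /= /hP jk.
by rewrite zy// jk.
Qed.

(** * Finite sets of numbers and ideals with the Baire property *)

Lemma finite_nat_ltP (A : set nat) :
  finite_set A <-> exists N, forall k, A k -> k < N.
Proof.
split=> [/finite_seqP[s ->]|[N AN]]; last exact: sub_finite_set (finite_II N).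
by exists (\max_(i <- s) i).+1 => k /= ks; rewrite ltnS; exact: leq_bigmax_seq.
Qed.

Lemma infinite_nat_ge (A : set nat) (n : nat) :
  infinite_set A -> exists2 k, A k & n <= k.
Proof.
move=> iA; apply: contrapT => H; apply: iA; apply/finite_nat_ltP; exists n => k Ak.
by rewrite ltnNge; apply/negP => nk; apply: H; exists k.
Qed.

Lemma infinite_parity (b : bool) : infinite_set [set k | odd k = b].
Proof.
move=> /(finite_image half); apply: (sub_infinite_set _ infinite_nat) => n _.
exists (b + n.*2); last exact: half_bit_double.
by rewrite /= oddD odd_double addbF oddb.
Qed.

Lemma infinite_range (T : Type) (f : nat -> T) : injective f -> infinite_set (range f).
Proof.
move=> finj; have : range f #= [set: nat] by apply: inj_card_eq => x y _ _ /finj.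
by move=> /eq_finite_set ->; exact: infinite_nat.
Qed.

(** A point matching [y] on infinitely many blocks lies outside the meager difference, so for it
    membership in [I] and in [O] coincide. This forces [O] to be empty, and then no such point
    belongs to [I]. *)
Lemma ideal_Baire_blocks (I : set (set nat)) :
  is_ideal I -> has_Baire_property (cantor_family I) ->
  exists2 h : nat -> nat, (forall k, finite_set (h @^-1` [set k])) &
    forall X, I X -> finite_set [set k | h @^-1` [set k] `<=` X].
Proof.
move=> [_ IU Isub Ifin IT] [O oO [F [ndF IOF]]].
have [h [y [hfin hy]]] := matching_blocks (fun i => nowhere_dense_avoidable (ndF i)).
have nF (z : cantor_space) :
    infinite_set [set k | forall j, h j = k -> z j = y j] -> ~ (\bigcup_n F n) z.
  by move=> iz [i _ Fz]; have [k kz ik] := infinite_nat_ge i iz; exact: (hy k z kz i ik).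
have O0 (x : cantor_space) : ~ O x.
  move=> Ox; have [n nO] : exists n, cylinder x n `<=` O.
    by apply: cylinder_nbhs; exact: open_nbhs_nbhs.
  (* Two points of [O] that are complementary from [n] on, each matching [y] on
     infinitely many blocks. *)
  pose z b : cantor_space := fun j =>
    if j < n then x j else if odd (h j) == b then y j else ~~ y j.
  have Iz b : I [set j | z b j].
    have : ~ (\bigcup_n F n) (z b).
      apply: nF => zfin; apply: (@infinite_parity b).
      (* Blocks meeting the first [n] positions are discarded, since there [z b] follows [x]; they
         are finitely many. *)
      apply: (@sub_finite_set _ _ (_ `|` h @` `I_n)); last first.
        by rewrite finite_setU; split; [exact: zfin|exact/finite_image/finite_II].
      move=> k /= kb; have [kn|kn] := pselect ((h @` `I_n) k); [by right|left].
      move=> j jk; rewrite /z; case: ltnP => [jn|_]; last by rewrite jk kb eqxx.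
      by exfalso; apply: kn; exists j.
    rewrite -IOF => nIO; apply: contrapT => nI; apply: nIO; right; split=> //.
    by apply: nO => j jn; rewrite /z jn.
  apply: IT; apply: Isub (IU _ _ (IU _ _ (Iz true) (Iz false)) (Ifin _ (finite_II n))).
  move=> j _; have [jn|jn] := ltnP j n; [by right|left].
  by rewrite /z /= ltnNge jn /=; case: (odd _); case: (y j); [left|right|right|left].
exists h => // X IX; apply: contrapT => iX.
(* The intersection of [X] with [y] stays in [I], yet matches [y] on every block contained in
   [X]. *)
pose z : cantor_space := fun j => `[< X j >] && y j.
apply: (nF z).
  apply: sub_infinite_set iX => k kX j jk; rewrite /z.
  by rewrite (asboolT (kX _ jk)).
rewrite -IOF; left; split; last exact: O0.
by apply: Isub IX => j /andP[/asboolP].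
Qed.

(** * P-ideals and the inequality between b and b(I) *)

Lemma P_ideal_bound (I : set (set nat)) (A : nat -> set nat) :
  is_P_ideal I -> (forall n, I (A n)) ->
  exists X (G : nat -> nat), I X /\ forall n j, A n j -> ~ X j -> j < G n.
Proof.
move=> [_ PI] /PI[X IX Xfin].
have [G GP] := choice (fun n => (finite_nat_ltP _).1 (Xfin n)).
by exists X, G; split=> // n j An nX; apply: GP.
Qed.

Lemma least_unbounded : unbounded_family bounding_number /\
  forall F, unbounded_family F -> bounding_number #<= F.
Proof. by apply: least_cardP; exists setT; exact: unbounded_family_setT. Qed.

Lemma least_ideal_unbounded (I : set (set nat)) : is_ideal I ->
  ideal_unbounded I (ideal_bounding_number I) /\
  forall F, ideal_unbounded I F -> ideal_bounding_number I #<= F.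
Proof.
move=> idI; apply: least_cardP; exists (D_ideal I).
exact: ideal_unbounded_D_ideal.
Qed.

Lemma bounding_number_le_image (T : Type) (D : set T) (f : T -> nat -> nat) :
  unbounded_family (f @` D) -> bounding_number #<= D.
Proof.
move=> /least_unbounded.2 le; apply: card_le_trans le _; exact: card_image_le.
Qed.

(* The summand [m] makes the search succeed even when [G] is bounded. *)
Lemma ex_lt_add (G : nat -> nat) (n : nat) : exists m, n < G m + m.
Proof. by exists n.+1; rewrite addnS ltnS leq_addl. Qed.

(** A generalized inverse of the function sending [m] to [G m + m]: it is finite-to-one, and
    enlarging [G] can only lower it. *)
Definition least_above (G : nat -> nat) (n : nat) : nat := ex_minn (ex_lt_add G n).

Lemma least_above_le G n m : n < G m + m -> least_above G n <= m.
Proof. by rewrite /least_above; case: ex_minnP => k _; exact. Qed.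

Lemma least_above_gt G n m : m < least_above G n -> G m + m <= n.
Proof. by move=> mn; rewrite leqNgt; apply/negP => /least_above_le; rewrite leqNgt mn. Qed.

Lemma finite_least_above_fibre G k : finite_set (least_above G @^-1` [set k]).
Proof.
apply/finite_nat_ltP; exists (G k + k) => n /= <-.
by rewrite /least_above; case: ex_minnP.
Qed.

(** For [f] in [F], [phi f] bounds the fibres of [f] off one member of [I]. If [G] dominated every
    [phi f], then [least_above G] would contradict [Funb]: off that member, [f n < least_above G n]
    gives [G (f n) <= n < phi f (f n)], leaving finitely many values [f n] and so finitely many
    [n]. *)
Lemma bounding_le_ideal_unbounded (I : set (set nat)) (F : set (nat -> nat)) :
  is_P_ideal I -> ideal_unbounded I F -> bounding_number #<= F.
Proof.
move=> PI [FD Funb]; have [[_ IU Isub Ifin _] _] := PI.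
have wit f : exists phi : nat -> nat, F f -> exists2 X, I X &
    forall j, ~ X j -> j < phi (f j).
  have [/FD Df|nF] := pselect (F f); last by exists id.
  have [X [phi [IX phiX]]] := P_ideal_bound PI Df.
  by exists phi => _; exists X => // j; exact: phiX.
have [phi phiP] := choice wit.
apply: (@bounding_number_le_image _ _ phi) => -[G Gb].
have [k|f Ff] := Funb (least_above G).
  exact/Ifin/finite_least_above_fibre.
apply; have [X IX phiX] := phiP _ Ff.
have fin : finite_set (\bigcup_(m in [set m | G m < phi f m]) `I_(phi f m)).
  by apply: bigcup_finite => [|m _]; [apply: Gb; exists f|exact: finite_II].
apply: Isub (IU _ _ IX (Ifin _ fin)) => n /= /least_above_gt Gn.
have [Xn|nX] := pselect (X n); [by left|right].
exists (f n); last exact: phiX.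
by rewrite /= (leq_ltn_trans (leq_trans (leq_addr _ _) Gn))// phiX.
Qed.

(** * Transport of unbounded families along the blocks *)

Section Blocks.
Variables (I : set (set nat)) (h : nat -> nat).
Hypothesis PI : is_P_ideal I.
Hypothesis hfin : forall k, finite_set (h @^-1` [set k]).
Hypothesis hI : forall X, I X -> finite_set [set k | h @^-1` [set k] `<=` X].

Let idI : is_ideal I := PI.1.

Lemma finite_preimage_blocks (K : set nat) : finite_set K -> finite_set (h @^-1` K).
Proof.
move=> fK; apply: (@sub_finite_set _ _ (\bigcup_(k in K) h @^-1` [set k])).
  by move=> j Kj; exists (h j).
exact: bigcup_finite.
Qed.

(** If [g] bounded the whole image, take [X] in [I] and [G] such that [g j <= m] implies [h j < G m]
    off [X]. Whenever [G m < f m], the block of index [G m + m] lies in [X] together with the set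
    where [least_above f (h j) < g j]; so this happens for finitely many [m], and [G] bounds [F]. *)
Lemma ideal_unbounded_least_above (F : set (nat -> nat)) : unbounded_family F ->
  ideal_unbounded I ((fun f => least_above f \o h) @` F).
Proof.
have [_ IU Isub Ifin _] := idI.
move=> Funb; split=> [_ [f Ff <-] k|g Dg].
  apply: Ifin; apply: (@finite_preimage_blocks (least_above f @^-1` [set k])).
  exact: finite_least_above_fibre.
apply: contrapT => H.
have Ile m : I [set j | g j <= m].
  elim: m => [|m IH]; first by apply: Isub (Dg 0) => j /=; rewrite leqn0 => /eqP.
  apply: Isub (IU _ _ IH (Dg m.+1)) => j /=.
  by rewrite leq_eqVlt => /predU1P[|]; [right|left].
have [X [G0 [IX G0X]]] := P_ideal_bound PI Ile.
have [G GP] := choice (fun m => (finite_nat_ltP _).1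
  (finite_image h (finite_II (G0 m)))).
apply: Funb; exists G => f Ff.
have If : I [set j | least_above f (h j) < g j].
  by apply: contrapT => nI; apply: H; exists (least_above f \o h) => //; exists f.
have /finite_nat_ltP[N NP] := hI (IU _ _ If IX).
apply/finite_nat_ltP; exists N => m /= Gf.
(* The summand [m] in the block index makes a bound on the index a bound on [m]. *)
apply: leq_ltn_trans (leq_addl (G m) m) _; apply: NP => j /= jk.
have [Xj|nX] := pselect (X j); [by right|left => /=].
rewrite ltnNge; apply/negP => gle.
have gm : g j <= m.
  by apply: leq_trans gle _; apply: least_above_le; rewrite jk ltn_add2r.
have : h j < G m by apply: GP; exists j => //; exact: G0X.
by rewrite jk ltnNge leq_addr.
Qed.

Lemma ideal_bounding_le_bounding : ideal_bounding_number I #<= bounding_number.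
Proof.
have [_ lb] := least_ideal_unbounded idI.
apply: card_le_trans (lb _ (ideal_unbounded_least_above least_unbounded.1)) _.
exact: card_image_le.
Qed.

Lemma blocks_positive (k : nat -> nat) (X : set nat) : injective k ->
  (forall j i, h i = k j -> X i) -> ~ I X.
Proof.
move=> kinj kX /hI; apply: sub_infinite_set (infinite_range kinj).
by move=> _ [j _ <-] i; exact: kX.
Qed.

(** Through [pickle], the blocks with coding indices play the points of the plane; a union of
    infinitely many whole blocks is not in [I]. *)
Definition column (n : nat) : set nat := [set i | exists j : nat, h i = pickle (n, j)].

Definition under_graph (f : nat -> nat) : set nat :=
  [set i | exists n j, j <= f n /\ h i = pickle (n, j)].

Lemma pickle_inj (T : countType) : injective (@pickle T).
Proof. exact: pcan_inj pickleK. Qed.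

Lemma column_positive n : ~ I (column n).
Proof.
by apply: (@blocks_positive (fun j => pickle (n, j))) => [j j' /pickle_inj[]//|j i ?];
  exists j.
Qed.

Lemma under_graph_positive f : ~ I (under_graph f).
Proof.
by apply: (@blocks_positive (fun n => pickle (n, f n))) => [j j' /pickle_inj[]//|n i ?];
  exists n, (f n).
Qed.

(** Distinct columns are disjoint, so if equal they would be empty and hence in [I]. *)
Lemma column_inj : injective column.
Proof.
move=> n m nm; apply: contrapT => neq; apply: (@column_positive n).
apply: ideal_finite idI _ _; apply/finite_nat_ltP; exists 0 => i [j ij].
have : column m i by rewrite -nm; exists j.
by move=> [j']; rewrite ij => /pickle_inj [].
Qed.

Lemma range_column_card : range column #= [set: nat].
Proof. by apply: inj_card_eq => n m _ _ /column_inj. Qed.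

Lemma column_under_graph n f : finite_set (column n `&` under_graph f).
Proof.
apply: (@sub_finite_set _ _ (h @^-1` ((fun j => pickle (n, j)) @` `I_(f n).+1))).
  move=> i [[j ij] [m [j' [j'f]]]]; rewrite ij => /pickle_inj [nm jj'].
  by exists j => //=; rewrite ltnS jj' nm.
exact/finite_preimage_blocks/finite_image/finite_II.
Qed.

(** If [C] separated, then off some [X] in [I] the heights of [C] in column [n] would stay below
    [G n]. When [G n < f n], the top block [(n, f n)] under the graph therefore lies in [X] together
    with [under_graph f] minus [C], a member of [I]; this occurs for finitely many [n], so [G]
    bounds [F]. *)
Lemma column_under_graph_gap (F : set (nat -> nat)) : unbounded_family F ->
  is_gap I (range column) (under_graph @` F).
Proof.
have [_ IU Isub Ifin _] := idI.
move=> Funb; split.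
- by move=> _ [n _ <-]; exact: column_positive.
- by move=> _ [f _ <-]; exact: under_graph_positive.
- by move=> _ _ [n _ <-] [f _ <-]; exact/Ifin/column_under_graph.
move=> [C [CA CB]].
have IC n : I (column n `&` C) by apply: CA; exists n.
have [X [G0 [IX G0X]]] := P_ideal_bound PI IC.
pose coord k : nat * nat := odflt (0, 0) (unpickle k).
have [G GP] := choice (fun n => (finite_nat_ltP _).1
  (finite_image (fun i => (coord (h i)).2) (finite_II (G0 n)))).
apply: Funb; exists G => f Ff.
have /hI/(finite_image (fun k => (coord k).1)) :=
  IU _ _ (CB _ (imageP _ Ff)) IX.
apply: sub_finite_set => n /= Gf; exists (pickle (n, f n)); last by rewrite /coord pickleK.
move=> i /= ik; have [Xi|nX] := pselect (X i); [by right|left].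
split=> [|Ci]; first by exists n, (f n).
have : f n < G n.
  apply: GP; exists i; last by rewrite /coord ik pickleK.
  by apply: G0X nX; split=> //; exists (f n).
by rewrite ltnNge (ltnW Gf).
Qed.

End Blocks.

(** * Lower bound for gaps, and conclusion *)

(** With [e] enumerating [A], [phi b n] bounds the intersection of [e n] and [b] off one member of
    [I]. A common bound of all [phi b] would yield a separating set. *)
Lemma bounding_le_gap (I : set (set nat)) (A B : set (set nat)) :
  is_P_ideal I -> is_gap I A B -> A #= [set: nat] -> bounding_number #<= B.
Proof.
move=> PI [_ _ AB nosep] /card_esym/card_set_bijP[e [eA _ esurj]].
have [[_ IU Isub Ifin _] _] := PI.
have wit b : exists phi : nat -> nat, B b -> exists2 X, I X &
    forall n j, e n j -> b j -> ~ X j -> j < phi n.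
  have [Bb|nB] := pselect (B b); last by exists id.
  have Ieb n : I (e n `&` b) by apply: AB => //; exact: eA.
  have [X [phi [IX phiX]]] := P_ideal_bound PI Ieb.
  by exists phi => _; exists X => // n j en bj; exact: phiX.
have [phi phiP] := choice wit.
apply: (@bounding_number_le_image _ _ phi) => -[G Gb].
(* Each [e n] is cut down to its part below [G n]. A point of [b] lost this way satisfies
   [G n <= j < phi b n] for some [n] unless it is in [X], which leaves finitely many points. *)
apply: nosep; exists [set j | forall n, e n j -> j < G n]; split=> [a Aa|b Bb].
  have [n _ <-] := esurj _ Aa; apply: Ifin; apply/finite_nat_ltP; exists (G n).
  by move=> j [enj]; exact.
have [X IX phiX] := phiP _ Bb.
have fin : finite_set (\bigcup_(m in [set m | G m < phi b m]) `I_(phi b m)).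
  by apply: bigcup_finite => [|m _]; [apply: Gb; exists b|exact: finite_II].
apply: Isub (IU _ _ IX (Ifin _ fin)) => j [bj nC].
have [Xj|nX] := pselect (X j); [by left|right].
have [n [enj Gj]] : exists n, e n j /\ G n <= j.
  apply: contrapT => H; apply: nC => n enj; rewrite ltnNge; apply/negP => Gj.
  by apply: H; exists n.
have jphi := phiX _ _ enj bj nX.
by exists n => //=; exact: leq_ltn_trans jphi.
Qed.

Theorem theorem6p6 (I : set (set nat)) (PI : is_P_ideal I)
    (BI : has_Baire_property (cantor_family I)) :
  rothberger_number I #= ideal_bounding_number I /\
  ideal_bounding_number I #= bounding_number.
Proof.
have [h hfin hI] := ideal_Baire_blocks PI.1 BI.
have ib : ideal_bounding_number I #= bounding_number.
  apply/card_eqPle; split; first exact: ideal_bounding_le_bounding PI hfin hI.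
  exact: bounding_le_ideal_unbounded PI (least_ideal_unbounded PI.1).1.
split=> //; apply: card_eq_trans (card_esym ib).
pose B0 := under_graph h @` bounding_number.
(* [rothberger_number] only ranges over sets of families, hence the singletons. *)
have B0K : set1 @` B0 #= B0.
  by apply: inj_card_eq => a b _ _ e; have : [set a] a by []; rewrite e.
have gap : has_gap I [set: nat] (set1 @` B0).
  exists (range (column h)), B0; split; last exact: card_esym.
  - exact: (column_under_graph_gap PI hfin hI least_unbounded.1).
  - exact: (range_column_card PI hI).
(* The gap just built excludes the default value [continuum_succ]. *)
rewrite /rothberger_number; case: pselect => [ex|]; last first.
  by case; exists (set1 @` B0).
have [[A [B [gAB cA cB]]] lb] := least_cardP ex.
apply/card_eqPle; split.
  apply: card_le_trans (lb _ gap) _; apply: card_le_trans (card_image_le _ _) _.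
  exact: card_image_le.
apply: card_le_trans (bounding_le_gap PI gAB cA) _.
by have /card_eqPle[] := cB.
Qed.
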